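(* Let $G$ be a non-trivial generalised partial-trust game. If $u_2(\mathrm{FT},\mathrm{C})$ is sufficiently high relative to the other payoffs in $G$, then enabling mixed-strategy simulation introduces Pareto-improving Nash equilibria in $G$.
   Context: A two-player normal-form game (NFG) $G=(S_1,S_2,u)$ has nonempty finite pure strategy sets and $u=(u_1,u_2):S_1\times S_2\to\mathbb R^2$. $\Sigma_i=\Delta(S_i)$, $u$ is extended by expectation, $\mathrm{NE}(G)$ is the set of Nash equilibria. For $\sigma_2\in\Sigma_2$, $\mathrm{br}(\sigma_2)\subseteq S_1$ is the set of pure best responses of player 1 and $\text{f-br}(\sigma_2)=\arg\max_{t_1\in \mathrm{br}(\sigma_2)}u_2(t_1,\sigma_2)$. A generalised partial-trust game is a finite NFG $G=(S_1,S_2,u)$ such that: (1) $S_2=\{\mathrm C,\mathrm D\}$; (2) player 1 has a strategy $\mathrm{WO}$ with $u(\mathrm{WO},\mathrm C)=u(\mathrm{WO},\mathrm D)=(0,0)$; (3) every $\mathrm T\in S_1\setminus\{\mathrm{WO}\}$ satisfies $u_1(\mathrm T,\mathrm C)>0>u_1(\mathrm T,\mathrm D)$ and $u_2(\mathrm T,\mathrm D)>u_2(\mathrm T,\mathrm C)>0$; (4a) for any two strategies $\mathrm T\neq \mathrm T'$ of player 1, $u_1(\mathrm T,\mathrm C)\ne u_1(\mathrm T',\mathrm C)$; (4b) whenever $u_1(\mathrm T,\mathrm C)>u_1(\mathrm T',\mathrm C)$, also $u_2(\mathrm T,\mathrm C)>u_2(\mathrm T',\mathrm C)$, $u_1(\mathrm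 T,\mathrm D)<u_1(\mathrm T',\mathrm D)$ and $u_2(\mathrm T,\mathrm D)>u_2(\mathrm T',\mathrm D)$; (5) for any $\mathrm T$, if a convex combination $\sigma_1=\lambda s_1+(1-\lambda)t_1$ of strategies $s_1,t_1\in S_1$ satisfies $u_1(\mathrm T,\sigma_2)=u_1(\sigma_1,\sigma_2)$ for all $\sigma_2\in\Sigma_2$, then also $u_2(\mathrm T,\sigma_2)=u_2(\sigma_1,\sigma_2)$ for all $\sigma_2\in\Sigma_2$. $\mathrm{FT}$ denotes the unique element of $\arg\max\{u_1(\mathrm T,\mathrm C): \mathrm T\in S_1\}$. The game is non-trivial if there is $\mathrm T\in S_1\setminus\{\mathrm{WO}\}$ with $$\frac{u_1(\mathrm T,\mathrm C)}{-u_1(\mathrm T,\mathrm D)}>\frac{u_1(\mathrm{FT},\mathrm C)}{-u_1(\mathrm{FT},\mathrm D)}.$$ For a simulation cost $c>0$, the mixed-strategy simulation game $G^c_{\text{m-sim}}$ is the (infinite) NFG in which player 1's pure strategies are $S_1\cup\{\text{m-sim}\}$, player 2's pure strategies are $\Sigma_2$, $u(s_1,\sigma_2)$ is as in $G$ for $s_1\in S_1$, and $$u_1(\text{m-sim},\sigma_2)=u_1(\mathrm{br}(\sigma_2),\sigma_2)-c,\qquad u_2(\text{m-sim},\sigma_2)=u_2(\text{f-br}(\sigma_2),\sigma_2).$$ Mixed strategies of player 2 in $G^c_{\text{m-sim}}$ are probability distributions over $\Sigma_2$; Nash equilibria are defined as usual. ''Enabling mixed-strategy simulation introduces Pareto-improving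 Nash equilibria in $G$'' means: there is $c_0>0$ such that for every simulation cost $0<c<c_0$ the game $G^c_{\text{m-sim}}$ has a Nash equilibrium $\mu^*$ with $u_i(\mu^* )>u_i(\sigma)$ for both $i\in\{1,2\}$ and every $\sigma\in\mathrm{NE}(G)$. *)

(* Defs.v *)
From HB Require Import structures.
From mathcomp Require Import all_boot all_order all_algebra.
From mathcomp Require Import all_classical all_reals all_analysis.

Set Implicit Arguments.
Unset Strict Implicit.
Unset Printing Implicit Defensive.

Import Order.TTheory GRing.Theory Num.Theory.

Local Open Scope classical_set_scope.
Local Open Scope ring_scope.

#[short(type="finPointedType")]
HB.structure Definition FinPointed := {T of Finite T & Pointed T}.

Record nfg (R : realType) (S1 S2 : Type) := NFG {
  u1 : S1 -> S2 -> R ;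
  u2 : S1 -> S2 -> R
}.

Definition is_nash (R : realType) (X1 X2 : Type) (U1 U2 : X1 -> X2 -> R)
    (x1 : X1) (x2 : X2) : Prop :=
  (forall y1, U1 y1 x2 <= U1 x1 x2) /\ (forall y2, U2 x1 y2 <= U2 x1 x2).

Section Mixed.
Variables (R : realType) (S : finType).

Record mixed := Mixed {
  mixed_val :> {ffun S -> R} ;
  _ : [forall s, 0 <= mixed_val s] && (\sum_s mixed_val s == 1)
}.

HB.instance Definition _ := [isSub for mixed_val].
HB.instance Definition _ := [Choice of mixed by <:].

Lemma pure_subproof (s0 : S) (f := [ffun s => (s == s0)%:R] : {ffun S -> R}) :
  [forall s, 0 <= f s] && (\sum_s f s == 1).
Proof.
apply/andP; split; first by apply/forallP => s; rewrite ffunE ler0n.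
rewrite (bigD1 s0) //= ffunE eqxx big1 ?addr0 // => s /negPf ss0.
by rewrite ffunE ss0.
Qed.

Definition pure (s0 : S) : mixed := Mixed (pure_subproof s0).

End Mixed.

HB.instance Definition _ (R : realType) (S : finPointedType) :=
  isPointed.Build (mixed R S) (pure R (point : S)).

(* The sigma-algebra generated by the coordinates; as S is finite, this is the
   Borel sigma-algebra of the simplex. *)
Definition coord_system (R : realType) (S : finPointedType) :
    set (set (mixed R S)) :=
  \bigcup_s preimage_set_system setT (fun sigma : mixed R S => sigma s)
    (@measurable _ R).

Definition mixedB (R : realType) (S : finPointedType) :=
  g_sigma_algebraType (@coord_system R S).

Section FiniteGame.
Variables (R : realType) (S1 S2 : finType).
Implicit Types (u : S1 -> S2 -> R) (G : nfg R S1 S2).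

Definition epay u (s1 : S1) (sigma2 : mixed R S2) : R :=
  \sum_s2 sigma2 s2 * u s1 s2.

Definition expay u (sigma1 : mixed R S1) (sigma2 : mixed R S2) : R :=
  \sum_s1 sigma1 s1 * epay u s1 sigma2.

Definition NE G (sigma1 : mixed R S1) (sigma2 : mixed R S2) : Prop :=
  is_nash (expay (u1 G)) (expay (u2 G)) sigma1 sigma2.

Definition br G (sigma2 : mixed R S2) : {set S1} :=
  [set s1 | [forall t1, epay (u1 G) t1 sigma2 <= epay (u1 G) s1 sigma2]]%SET.

Definition fbr G (sigma2 : mixed R S2) : {set S1} :=
  [set s1 in br G sigma2 |
    [forall t1 in br G sigma2,
       epay (u2 G) t1 sigma2 <= epay (u2 G) s1 sigma2]]%SET.

(* The common value on A of a function f that is constant on A (junk value 0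
   if A is empty); only used for u1 on br and for u2 on fbr. *)
Definition value_on (A : {set S1}) (f : S1 -> R) : R :=
  if [pick s in A] is Some s then f s else 0.

(* Player 1's pure strategies are S1 plus None, which stands for m-sim. *)
Definition msim G (c : R) : nfg R (option S1) (mixed R S2) := {|
  u1 := fun s sigma2 =>
    if s is Some s1 then epay (u1 G) s1 sigma2
    else value_on (br G sigma2) (fun s1 => epay (u1 G) s1 sigma2) - c ;
  u2 := fun s sigma2 =>
    if s is Some s1 then epay (u2 G) s1 sigma2
    else value_on (fbr G sigma2) (fun s1 => epay (u2 G) s1 sigma2)
|}.

End FiniteGame.

Section MixedSimulation.
Variables (R : realType) (S1 : finType) (S2 : finPointedType).
Implicit Types G : nfg R S1 S2.

Definition sim_expay (u : option S1 -> mixed R S2 -> R)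
    (mu1 : mixed R (option S1)) (mu2 : probability (mixedB R S2) R) : R :=
  \sum_s mu1 s * Rintegral mu2 setT (u s).

Definition msim_NE G (c : R)
    (mu1 : mixed R (option S1)) (mu2 : probability (mixedB R S2) R) : Prop :=
  is_nash (sim_expay (u1 (msim G c))) (sim_expay (u2 (msim G c))) mu1 mu2.

Definition msim_introduces_pareto_improving_NE G : Prop :=
  exists2 c0 : R, 0 < c0 & forall c : R, 0 < c < c0 ->
    exists mu1 mu2, msim_NE G c mu1 mu2 /\
      forall sigma1 sigma2, NE G sigma1 sigma2 ->
        expay (u1 G) sigma1 sigma2 < sim_expay (u1 (msim G c)) mu1 mu2 /\
        expay (u2 G) sigma1 sigma2 < sim_expay (u2 (msim G c)) mu1 mu2.

End MixedSimulation.

Inductive action := C | D.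

Definition bool_of_action (a : action) : bool := if a is C then true else false.
Definition action_of_bool (b : bool) : action := if b then C else D.
Lemma bool_of_actionK : cancel bool_of_action action_of_bool.
Proof. by case. Qed.

HB.instance Definition _ := Finite.copy action (can_type bool_of_actionK).
HB.instance Definition _ := isPointed.Build action C.

Section PartialTrust.
Variables (R : realType) (S1 : finType).
Implicit Types G : nfg R S1 action.

Record gen_partial_trust G (WO : S1) : Prop := GenPartialTrust {
  gpt_WO : forall a, u1 G WO a = 0 /\ u2 G WO a = 0 ;
  gpt_trust : forall T, T != WO ->
    [/\ u1 G T C > 0, 0 > u1 G T D, u2 G T D > u2 G T C & u2 G T C > 0] ;
  gpt_distinct : forall T T', T != T' -> u1 G T C != u1 G T' C ;
  gpt_monotone : forall T T', u1 G T C > u1 G T' C ->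
    [/\ u2 G T C > u2 G T' C, u1 G T D < u1 G T' D & u2 G T D > u2 G T' D] ;
  gpt_convex : forall (T s1 t1 : S1) (lambda : R) (sigma1 : mixed R S1),
    0 <= lambda <= 1 ->
    (forall r, sigma1 r = lambda * (r == s1)%:R + (1 - lambda) * (r == t1)%:R) ->
    (forall sigma2, epay (u1 G) T sigma2 = expay (u1 G) sigma1 sigma2) ->
    (forall sigma2, epay (u2 G) T sigma2 = expay (u2 G) sigma1 sigma2)
}.

Definition is_full_trust G (FT : S1) : Prop :=
  [set T | [forall T', u1 G T' C <= u1 G T C]]%SET = [set FT]%SET.

Definition nontrivial G (WO FT : S1) : Prop :=
  exists2 T, T != WO &
    u1 G T C / - u1 G T D > u1 G FT C / - u1 G FT D.

End PartialTrust.

(* Main.v *)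
(* Walking out is the outcome of every equilibrium of G, so it suffices to find
   an equilibrium of the simulation game with positive payoffs.  Let q be the
   least probability of C at which FT is still a best response; non-triviality
   makes player 1's payoff there positive.  Player 2 plays q with probability
   1 - e and defects otherwise; player 1 mixes m-sim with the next strategy T1
   on the upper envelope, and e = c / (- u1 T1 D) makes them equally good for
   player 1.  The weight x on m-sim makes player 2 indifferent between q and
   defection; x is of order 1 / u2 FT C, so when this payoff is large,
   what player 2 gains from being simulated at a commitment below q is less than
   what it loses against T1 by not defecting. *)

Require Import Defs.
From mathcomp Require Import all_boot all_order all_algebra.
From mathcomp Require Import all_classical all_reals all_analysis.
From mathcomp Require Import measurable_realfun ring lra.
Set Implicit Arguments.
Unset Strict Implicit.
Unset Printing Implicit Defensive.
Import Order.TTheory GRing.Theory Num.Theory.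
Local Open Scope classical_set_scope.
Local Open Scope ring_scope.

(** * Mixed strategies over a finite set *)

Section Simplex.
Variables (R : realType) (S : finType).
Implicit Type sigma : mixed R S.

Lemma mixed_ge0 sigma s : 0 <= sigma s.
Proof. by case: sigma => f /= /andP[/forallP]. Qed.

Lemma mixed_sum1 sigma : \sum_s sigma s = 1.
Proof. by case: sigma => f /= /andP[_ /eqP]. Qed.

Lemma mixed_le1 sigma s : sigma s <= 1.
Proof.
rewrite -(mixed_sum1 sigma) (bigD1 s)//= lerDl.
by apply: sumr_ge0 => t _; exact: mixed_ge0.
Qed.

Lemma mixed_average_le sigma (f : S -> R) b :
  (forall s, f s <= b) -> \sum_s sigma s * f s <= b.
Proof.
move=> fb; rewrite -[leRHS]mul1r -(mixed_sum1 sigma) mulr_suml.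
by apply: ler_sum => s _; rewrite ler_wpM2l// mixed_ge0.
Qed.

Lemma two_mixed_subproof (s0 s1 : S) (x : R) (x01 : 0 <= x <= 1)
  (f := [ffun s => x * (s == s0)%:R + (1 - x) * (s == s1)%:R]) :
  [forall s, 0 <= f s] && (\sum_s f s == 1).
Proof.
have [x0 x1] := andP x01.
apply/andP; split.
  by apply/forallP => s; rewrite ffunE addr_ge0// mulr_ge0// subr_ge0.
have sum1 t : \sum_s (s == t)%:R = 1 :> R.
  by rewrite (bigD1 t)//= eqxx big1 ?addr0// => s /negPf ->.
under eq_bigr do rewrite ffunE.
by rewrite big_split/= -!mulr_sumr !sum1 !mulr1 subrKC.
Qed.

Definition two_mixed s0 s1 x (x01 : 0 <= x <= 1) : mixed R S :=
  Mixed (two_mixed_subproof s0 s1 x01).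

Lemma sum_two_mixed s0 s1 x (x01 : 0 <= x <= 1) (f : S -> R) :
  \sum_s two_mixed s0 s1 x01 s * f s = x * f s0 + (1 - x) * f s1.
Proof.
have sumf t : \sum_s (s == t)%:R * f s = f t.
  rewrite (bigD1 t)//= eqxx mul1r big1 ?addr0// => s /negPf ->.
  by rewrite mul0r.
under eq_bigr do rewrite /two_mixed/= ffunE mulrDl -!mulrA.
by rewrite big_split/= -!mulr_sumr !sumf.
Qed.

End Simplex.

(** * Measurability and integration of the simulation payoffs *)

Section SimulationMeasurability.
Variables (R : realType) (S1 : finType) (S2 : finPointedType).
Implicit Types (G : nfg R S1 S2) (u : S1 -> S2 -> R).

Local Notation X := (mixedB R S2).
(** Enough for integrability against every probability, and preserved by averaging over player 1's
    mixed strategies. *)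
Definition bounded_measurable (f : X -> R) : Prop :=
  measurable_fun setT f /\ exists M : R, forall sigma, `|f sigma| <= M.

Lemma measurable_coord s :
  measurable_fun setT (fun sigma : X => (sigma : mixed R S2) s : R).
Proof.
move=> _ Y mY; apply: sub_sigma_algebra; exists s => //.
by exists Y.
Qed.

Lemma measurable_forall (I : finType) (P : I -> X -> bool) :
  (forall i, measurable_fun setT (P i)) ->
  measurable_fun setT (fun sigma => [forall i, P i sigma]).
Proof.
move=> mP _; apply: (measurable_fun_bool true) => //; rewrite setTI.
rewrite (_ : _ @^-1` _ = \bigcap_(i in [set: I]) (P i @^-1` [set true])).
  apply: fin_bigcap_measurable => // i _.
  by rewrite -[X in measurable X]setTI; exact: mP.
apply/seteqP; split => [sigma /= /forallP Psig i _|sigma Psig].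
  exact: Psig.
by apply/forallP => i; exact: Psig.
Qed.

Lemma measurable_epay u s : measurable_fun (setT : set X) (epay u s).
Proof.
apply: measurable_sum => a.
by apply: measurable_funM => //; exact: measurable_coord.
Qed.

Lemma epay_bounded u s (sigma : mixed R S2) :
  `|epay u s sigma| <= \sum_a `|u s a|.
Proof.
apply: le_trans (ler_norm_sum _ _ _) _; apply: ler_sum => a _.
by rewrite normrM ger0_norm ?mixed_ge0// ler_piMl// mixed_le1.
Qed.

Lemma measurable_in_br G s :
  measurable_fun (setT : set X) (fun sigma => s \in br G sigma).
Proof.
under eq_fun do rewrite inE.
apply: measurable_forall => t.
by apply: measurable_fun_ler; exact: measurable_epay.
Qed.

Lemma measurable_in_fbr G s :
  measurable_fun (setT : set X) (fun sigma => s \in fbr G sigma).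
Proof.
under eq_fun do rewrite inE.
apply: measurable_and; first exact: measurable_in_br.
apply: measurable_forall => t.
under eq_fun do rewrite implybE.
apply: measurable_or; first by apply: measurable_neg; exact: measurable_in_br.
by apply: measurable_fun_ler; exact: measurable_epay.
Qed.

Lemma value_on_bounded (A : {set S1}) (f : S1 -> R) :
  `|value_on A f| <= \sum_s `|f s|.
Proof.
rewrite /value_on; case: pickP => [s _|_]; last by rewrite normr0 sumr_ge0.
by rewrite (bigD1 s)//= lerDl sumr_ge0.
Qed.

(** [A] takes finitely many values, so the function is a finite sum over the possible values [B],
    with one fixed payoff (or 0) on each event [A sigma == B]. *)
Lemma measurable_value_on (A : X -> {set S1}) u :
  (forall s, measurable_fun setT (fun sigma => s \in A sigma)) ->
  measurable_fun setT
    (fun sigma => value_on (A sigma) (fun s => epay u s sigma)).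
Proof.
move=> mA.
rewrite [X in measurable_fun _ X](_ : _ = (fun sigma => \sum_B
    (if A sigma == B then value_on B (fun s => epay u s sigma) else 0)));
  last first.
  apply/funext => sigma; rewrite (bigD1 (A sigma))//= eqxx big1 ?addr0// => B.
  by rewrite eq_sym => /negPf ->.
apply: measurable_sum => B; apply: measurable_fun_ifT => //.
- rewrite [X in measurable_fun _ X](_ : _ =
      (fun sigma => [forall s,
        if s \in B then s \in A sigma else s \notin A sigma])).
    apply: measurable_forall => s /=; case: (s \in B) => //.
    exact: measurable_neg.
  apply/funext => sigma; apply/eqP/forallP => [-> s|AB].
    by case: ifP => // ->.
  by apply/setP => s; have := AB s; case: ifP => // _ /negPf.
- by rewrite /value_on; case: pickP => // s _; exact: measurable_epay.
Qed.

Lemma bounded_measurable_msim_u1 G c s : bounded_measurable (u1 (msim G c) s).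
Proof.
case: s => [s|] /=.
  split; first exact: measurable_epay.
  by exists (\sum_a `|u1 G s a|); exact: epay_bounded.
split.
  apply: measurable_funB => //.
  by apply: measurable_value_on; exact: measurable_in_br.
exists (\sum_s (\sum_a `|u1 G s a|) + `|c|) => sigma.
apply: le_trans (ler_normB _ _) _; rewrite lerD2r.
apply: le_trans (value_on_bounded _ _) _; apply: ler_sum => s _.
exact: epay_bounded.
Qed.

Lemma bounded_measurable_msim_u2 G c s : bounded_measurable (u2 (msim G c) s).
Proof.
case: s => [s|] /=.
  split; first exact: measurable_epay.
  by exists (\sum_a `|u2 G s a|); exact: epay_bounded.
split; first by apply: measurable_value_on; exact: measurable_in_fbr.
exists (\sum_s (\sum_a `|u2 G s a|)) => sigma.
apply: le_trans (value_on_bounded _ _) _; apply: ler_sum => s _.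
exact: epay_bounded.
Qed.

Lemma bounded_measurable_integrable (mu : probability X R) (f : X -> R) :
  bounded_measurable f -> mu.-integrable setT (EFin \o f).
Proof.
move=> [mf [M fM]]; apply: measurable_bounded_integrable => //.
  exact: fin_num_fun_lty.
exists M; split => [|x Mx sigma _]; first exact: num_real.
exact: le_trans (fM _) (ltW Mx).
Qed.

(** Moving the finite sum inside the integral lets player 2's payoff be bounded commitment by
    commitment. *)
Lemma sim_expayE (u : option S1 -> X -> R) (mu1 : mixed R (option S1))
    (mu2 : probability X R) : (forall s, bounded_measurable (u s)) ->
  sim_expay u mu1 mu2 =
  Rintegral mu2 setT (fun sigma => \sum_s mu1 s * u s sigma).
Proof.
move=> bu; have iu s := bounded_measurable_integrable mu2 (bu s).
have iu' s : mu2.-integrable setT (EFin \o (fun sigma => mu1 s * u s sigma)).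
  apply: (@eq_integrable _ _ _ _ _ _
    (fun sigma => (mu1 s)%:E * (u s sigma)%:E)%E) => //.
  exact: (integrableZl measurableT (mu1 s) (iu s)).
rewrite /sim_expay [RHS]/Rintegral.
under [in RHS]eq_integral do rewrite -sumEFin.
rewrite integral_sum//= -sum_fine; last first.
  by move=> s _; exact: (integrable_fin_num measurableT (iu' s)).
by apply: eq_bigr => s _; rewrite -RintegralZl.
Qed.

Lemma bounded_measurable_average (u : option S1 -> X -> R)
    (mu1 : mixed R (option S1)) : (forall s, bounded_measurable (u s)) ->
  bounded_measurable (fun sigma => \sum_s mu1 s * u s sigma).
Proof.
move=> bu; split.
  apply: measurable_sum => s; apply: measurable_funM => //; exact: (bu s).1.
have [M uM] := choice (fun s => (bu s).2).
exists (\sum_s M s) => sigma; apply: le_trans (ler_norm_sum _ _ _) _.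
apply: ler_sum => s _; rewrite normrM ger0_norm ?mixed_ge0//.
by apply: le_trans (uM s sigma); rewrite ler_piMl// mixed_le1.
Qed.

(** This reduces player 2's deviations, which are arbitrary distributions over commitments, to
    single commitments. *)
Lemma sim_expay_le (u : option S1 -> X -> R) (mu1 : mixed R (option S1))
    (mu2 : probability X R) v : (forall s, bounded_measurable (u s)) ->
  (forall sigma, \sum_s mu1 s * u s sigma <= v) -> sim_expay u mu1 mu2 <= v.
Proof.
move=> bu uv; rewrite sim_expayE//.
rewrite -[leRHS]mulr1 -[1]/(fine 1%:E) -(probability_setT mu2) -Rintegral_cst//.
apply: le_Rintegral => //.
  exact/bounded_measurable_integrable/bounded_measurable_average.
by apply: bounded_measurable_integrable; split => //; exists `|v|.
Qed.

(** As [f] may change sign, its positive and negative parts are integrated separately. *)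
Lemma integral_bernoulli_prob_signed (p : R) (f : bool -> R) : 0 <= p <= 1 ->
  Rintegral (bernoulli_prob p) setT f = p * f true + (1 - p) * f false.
Proof.
move=> p01; rewrite /Rintegral integralE !integral_bernoulli_prob//.
rewrite /= !funeposE !funenegE -!EFin_max/=.
have fE b : f b = Num.max (f b) 0 - Num.max (- f b) 0.
  by rewrite /Order.max oppr_lt0; case: ltgtP => [|| ->]; rewrite ?oppr0; lra.
by rewrite [in RHS](fE true) [in RHS](fE false) /unstable.onem; ring.
Qed.

(** The measure is the push-forward of a Bernoulli law along [true] to [sigma], [false] to [tau]. *)
Lemma two_point_probability (sigma tau : mixed R S2) (p : R) : 0 <= p <= 1 ->
  exists mu : probability X R, forall f : X -> R, bounded_measurable f ->
    Rintegral mu setT f = p * f sigma + (1 - p) * f tau.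
Proof.
move=> p01; pose Y (b : bool) : X := if b then sigma else tau.
have mY : measurable_fun setT Y by exact: measurable_fun_ifT.
pose Y' : {mfun bool >-> X} := mfun_Sub (mem_set mY).
exists (distribution (bernoulli_prob p) Y') => f [mf [M fM]].
rewrite -(integral_bernoulli_prob_signed (f \o Y))// /Rintegral.
rewrite integral_distribution//; first exact/measurable_EFinP.
apply: measurable_bounded_integrable => //; first exact: fin_num_fun_lty.
exists M; split => [|x Mx b _]; first exact: num_real.
exact: le_trans (fM _) (ltW Mx).
Qed.

(** The measure is chosen before [u] and [mu1], so that one [mu2] serves both payoffs and all
    deviations of player 1. *)
Lemma two_point_sim_expay (sigma tau : mixed R S2) (p : R) : 0 <= p <= 1 ->
  exists mu2 : probability X R, 
      forall (u : option S1 -> X -> R) (mu1 : mixed R (option S1)),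
      (forall s, bounded_measurable (u s)) ->
    sim_expay u mu1 mu2 =
    p * (\sum_s mu1 s * u s sigma) + (1 - p) * (\sum_s mu1 s * u s tau).
Proof.
move=> /(two_point_probability sigma tau)[mu2 mu2E]; exists mu2 => u mu1 bu.
rewrite sim_expayE// mu2E//.
exact: bounded_measurable_average.
Qed.

End SimulationMeasurability.

(** All best responses give player 1 the same payoff, so the element picked by [value_on] is
    immaterial. *)
Lemma value_on_br (R : realType) (S1 S2 : finType) (G : nfg R S1 S2) sigma s :
  s \in br G sigma ->
  value_on (br G sigma) (fun t => epay (u1 G) t sigma) = epay (u1 G) s sigma.
Proof.
move=> s_br; rewrite /value_on; case: pickP => [t t_br|/(_ s)]; last first.
  by rewrite s_br.
move: s_br t_br; rewrite !inE => /forallP s_br /forallP t_br.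
by apply/le_anti; rewrite s_br t_br.
Qed.

Lemma value_on_fbr (R : realType) (S1 S2 : finType) (G : nfg R S1 S2) sigma s :
  s \in fbr G sigma ->
  value_on (fbr G sigma) (fun t => epay (u2 G) t sigma) = epay (u2 G) s sigma.
Proof.
move=> s_fbr; rewrite /value_on; case: pickP => [t t_fbr|/(_ s)]; last first.
  by rewrite s_fbr.
move: s_fbr t_fbr; rewrite !inE.
move=> /andP[s_br /forall_inP s_max] /andP[t_br /forall_inP t_max].
by apply/le_anti; rewrite s_max ?t_max// inE.
Qed.

(** * Payoffs as affine functions of the probability of cooperation *)

Section TwoActions.
Variable R : realType.

Definition aff (f : action -> R) (y : R) : R := y * f C + (1 - y) * f D.

Lemma sum_action (f : action -> R) : \sum_a f a = f C + f D.
Proof.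
rewrite (bigD1 C)//= (bigD1 D)//= big_pred0 ?addr0//.
by case.
Qed.

Lemma mixed_D (sigma : mixed R action) : sigma D = 1 - sigma C.
Proof. by have := mixed_sum1 sigma; rewrite sum_action; lra. Qed.

Lemma epay_aff (S1 : finType) (u : S1 -> action -> R) s sigma :
  epay u s sigma = aff (u s) (sigma C).
Proof. by rewrite /epay sum_action mixed_D. Qed.

Lemma two_mixed_CD (y : R) (y01 : 0 <= y <= 1) : two_mixed C D y01 C = y.
Proof. by rewrite /two_mixed/= ffunE eqxx mulr1 mulr0 addr0. Qed.

End TwoActions.

Lemma exists_pos_lower_bound (R : realType) (I : finType) (e : I -> R) :
  (forall i, 0 < e i) -> exists2 e0, 0 < e0 & forall i, e0 <= e i.
Proof.
(* Including 1 in the minimum covers an empty [I]. *)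
move=> e_gt0; exists (\big[Num.min/1]_i e i); last first.
  by move=> i; exact: bigmin_le.
by apply/lt_bigmin.
Qed.

(** * Equilibria of the partial-trust game *)

Section Game.
Variables (R : realType) (S1 : finType) (WO FT : S1) (G : nfg R S1 action).
Hypothesis gptG : gen_partial_trust G WO.

Local Notation A T := (u1 G T C).
Local Notation B T := (u1 G T D).

Lemma aff_WO u y : u = u1 G \/ u = u2 G -> aff (u WO) y = 0.
Proof.
have [[a1 a2] [b1 b2]] := (gpt_WO gptG C, gpt_WO gptG D).
by rewrite /aff => -[] ->; rewrite ?a1 ?a2 ?b1 ?b2 !mulr0 addr0.
Qed.

Lemma u1_D_le0 T : B T <= 0.
Proof.
have [->|/(gpt_trust gptG)[_ /ltW //]] := eqVneq T WO.
by rewrite (gpt_WO gptG D).1.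
Qed.

Lemma u2_C_le_D T : u2 G T C <= u2 G T D.
Proof.
have [->|/(gpt_trust gptG)[_ _ /ltW //]] := eqVneq T WO.
by rewrite (gpt_WO gptG D).2 (gpt_WO gptG C).2.
Qed.

(** Player 1 can only walk out: if player 2 surely defects, every other strategy loses to [WO]; if
    [C] has positive probability, any weight on another strategy makes [D] a profitable
    deviation. *)
Lemma NE_payoff0 sigma1 sigma2 : NE G sigma1 sigma2 ->
  expay (u1 G) sigma1 sigma2 = 0 /\ expay (u2 G) sigma1 sigma2 = 0.
Proof.
move=> [ne1 ne2].
suff supp T : T != WO -> sigma1 T = 0.
  by split; apply: big1 => T _; have [->|/supp ->] := eqVneq T WO;
    rewrite ?mul0r// epay_aff aff_WO ?mulr0//; [left|right].
have y_ge0 := mixed_ge0 sigma2 C.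
have expayE u : expay u sigma1 sigma2 = \sum_T sigma1 T * aff (u T) (sigma2 C).
  by apply: eq_bigr => S _; rewrite epay_aff.
have [y0|y_neq0] := eqVneq (sigma2 C) 0.
  have := ne1 (pure R WO); rewrite expayE.
  have -> : expay (u1 G) (pure R WO) sigma2 = 0.
    rewrite /expay big1// => S _; rewrite /pure/= ffunE.
    have [->|] := eqVneq S WO; rewrite ?mul0r//.
    by rewrite epay_aff aff_WO ?mulr0//; left.
  rewrite -oppr_le0 -sumrN => sum_le0.
  have term_ge0 S : 0 <= - (sigma1 S * aff (u1 G S) (sigma2 C)).
    rewrite oppr_ge0 y0 /aff mul0r add0r subr0 mul1r.
    by rewrite mulr_ge0_le0 ?mixed_ge0// u1_D_le0.
  move=> TWO; have [_ BT _ _] := gpt_trust gptG TWO.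
  have sum_ge0 := @sumr_ge0 _ _ (index_enum S1) xpredT _ (fun S _ => term_ge0 S).
  have /eqP : \sum_S - (sigma1 S * aff (u1 G S) (sigma2 C)) = 0.
    by apply/le_anti/andP.
  rewrite psumr_eq0// => /allP /(_ T (mem_index_enum _)) /=.
  rewrite y0 /aff mul0r add0r subr0 mul1r oppr_eq0 mulf_eq0 (lt_eqF BT) orbF.
  by move/eqP.
have y_gt0 : 0 < sigma2 C by rewrite lt_def y_neq0.
have := ne2 (pure R D); rewrite expayE.
have -> : expay (u2 G) sigma1 (pure R D) = \sum_T sigma1 T * u2 G T D.
  apply: eq_bigr => S _; rewrite epay_aff /aff /pure/= ffunE/=.
  by rewrite mul0r subr0 mul1r add0r.
rewrite -subr_le0 -sumrB => sum_le0.
have term_ge0 S : 0 <= sigma1 S * u2 G S D - sigma1 S * aff (u2 G S) (sigma2 C).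
  rewrite -mulrBr mulr_ge0 ?mixed_ge0// /aff.
  have -> : u2 G S D - (sigma2 C * u2 G S C + (1 - sigma2 C) * u2 G S D) =
    sigma2 C * (u2 G S D - u2 G S C) by ring.
  by rewrite mulr_ge0// subr_ge0 u2_C_le_D.
move=> TWO; have [_ _ dc _] := gpt_trust gptG TWO.
have sum_ge0 := @sumr_ge0 _ _ (index_enum S1) xpredT _ (fun S _ => term_ge0 S).
have /eqP : \sum_S
    (sigma1 S * u2 G S D - sigma1 S * aff (u2 G S) (sigma2 C)) = 0.
  by apply/le_anti/andP.
rewrite psumr_eq0// => /allP /(_ T (mem_index_enum _)) /=.
rewrite -mulrBr mulf_eq0 => /orP[/eqP //|]; rewrite /aff => /eqP eq0.
have : 0 < sigma2 C * (u2 G T D - u2 G T C) by rewrite mulr_gt0// subr_gt0.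
nra.
Qed.

(** * Simulation payoffs at a given commitment *)

Lemma br_at_defection (sigma : mixed R action) :
  sigma C = 0 -> br G sigma = [set WO]%SET.
Proof.
move=> sC; have epay_sigma T : epay (u1 G) T sigma = B T.
  by rewrite epay_aff /aff sC mul0r add0r subr0 mul1r.
apply/setP => T; rewrite !inE; apply/forallP/eqP => [/(_ WO)|-> S].
  rewrite !epay_sigma (gpt_WO gptG D).1; apply: contraTeq => TWO.
  by have [_ BT _ _] := gpt_trust gptG TWO; rewrite -ltNge.
by rewrite !epay_sigma (gpt_WO gptG D).1 u1_D_le0.
Qed.

Lemma msim_at_defection c (sigma : mixed R action) : sigma C = 0 ->
  u1 (msim G c) None sigma = - c /\ u2 (msim G c) None sigma = 0.
Proof.
move=> sC; have brE := br_at_defection sC.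
have WO_br : WO \in br G sigma by rewrite brE inE.
have WO_fbr : WO \in fbr G sigma.
  rewrite inE WO_br; apply/forall_inP => T; rewrite brE inE => /eqP ->.
  exact: lexx.
rewrite /= (value_on_br WO_br) (value_on_fbr WO_fbr) !epay_aff.
by rewrite !aff_WO ?add0r//; [right|left].
Qed.

(* A best response [T] to [sigma] beats walking out, which bounds the
   probability of [C] from below. *)
Lemma br_cooperation_bound (sigma : mixed R action) T :
  T != WO -> T \in br G sigma -> - B T <= sigma C * (A T - B T).
Proof.
move=> TWO; rewrite inE => /forallP /(_ WO).
rewrite !epay_aff aff_WO//; last by left.
rewrite /aff; lra.
Qed.

Hypothesis ftG : is_full_trust G FT.

Lemma full_trust_max T : T != FT -> A T < A FT.
Proof.
move=> TFT; rewrite lt_neqAle (gpt_distinct gptG TFT)/=.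
have : FT \in [set FT]%SET by rewrite set11.
by rewrite -ftG inE => /forallP.
Qed.

(** By monotonicity [FT] gives player 2 the most against both actions, so favourable tie-breaking
    selects it. *)
Lemma msim_at_full_trust c (sigma : mixed R action) : FT \in br G sigma ->
  u1 (msim G c) None sigma = aff (u1 G FT) (sigma C) - c /\
  u2 (msim G c) None sigma = aff (u2 G FT) (sigma C).
Proof.
move=> FT_br; have FT_fbr : FT \in fbr G sigma.
  rewrite inE FT_br; apply/forall_inP => T _; rewrite !epay_aff /aff.
  have [->//|TFT] := eqVneq T FT.
  have [cc _ dd] := gpt_monotone gptG (full_trust_max TFT).
  have s1 : 0 <= 1 - sigma C by rewrite subr_ge0 mixed_le1.
  by rewrite lerD// ler_wpM2l ?mixed_ge0// ltW.
by rewrite /= (value_on_br FT_br) (value_on_fbr FT_fbr) !epay_aff.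
Qed.

(** Single crossing: the advantage of [FT] over any [T] grows with the probability of [C]. *)
Lemma full_trust_br q (sigma : mixed R action) :
  (forall T, aff (u1 G T) q <= aff (u1 G FT) q) -> q <= sigma C ->
  FT \in br G sigma.
Proof.
move=> FTq qs; rewrite inE; apply/forallP => T; rewrite !epay_aff.
have [->//|TFT] := eqVneq T FT.
have AT := full_trust_max TFT; have [_ BT _] := gpt_monotone gptG AT.
have := FTq T; rewrite /aff => diff_ge0.
have : 0 <= (sigma C - q) * ((A FT - A T) + (B T - B FT)).
  by rewrite mulr_ge0 ?subr_ge0// ltW// addr_gt0// subr_gt0.
lra.
Qed.

(** Below [q] the simulator's response is not [FT]. Any other response but [WO] requires enough
    cooperation to beat walking out, and this turns the bound [u2 G T D] on player 2's payoff into
    one linear in [sigma C]. *)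
Lemma msim_u2_bound c K q T1 (sigma : mixed R action) :
  (forall y, y < q -> aff (u1 G FT) y < aff (u1 G T1) y) ->
  (forall T, T != FT -> T != WO -> u2 G T D * (A T - B T) <= K * - B T) ->
  0 <= K -> sigma C < q ->
  u2 (msim G c) None sigma <= sigma C * K.
Proof.
(* An empty set would give the default value 0, which also satisfies the bound. *)
move=> FTlt Kge K_ge0 sq; rewrite /= /value_on; case: pickP => [T|_]; last first.
  by rewrite mulr_ge0// mixed_ge0.
rewrite !inE => /andP[/forallP T_br _].
have TFT : T != FT.
  apply: contraTneq (T_br T1) => ->; rewrite !epay_aff -ltNge; exact: FTlt.
rewrite epay_aff; have [->|TWO] := eqVneq T WO.
  by rewrite aff_WO//; [rewrite mulr_ge0// mixed_ge0|right].
have T_br' : T \in br G sigma by rewrite inE; apply/forallP.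
have := br_cooperation_bound TWO T_br'; have := Kge _ TFT TWO.
have [AT BT dc c_gt0] := gpt_trust gptG TWO.
move=> dK sB; apply: (@le_trans _ _ (u2 G T D)).
  rewrite /aff -subr_ge0.
  have -> : u2 G T D - (sigma C * u2 G T C + (1 - sigma C) * u2 G T D) =
    sigma C * (u2 G T D - u2 G T C) by ring.
  by rewrite mulr_ge0 ?mixed_ge0// subr_ge0 ltW.
have AB : 0 < A T - B T by rewrite subr_gt0 (lt_trans BT).
rewrite -(ler_pM2r AB); apply: le_trans dK _.
by rewrite -mulrA [leRHS]mulrCA ler_wpM2l.
Qed.

(** * The breakpoint of full trust *)

Hypothesis ntG : nontrivial G WO FT.

Lemma full_trust_neq_WO : FT != WO.
Proof.
have [T TWO _] := ntG; have [AT _ _ _] := gpt_trust gptG TWO.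
apply/eqP => FTWO; move: (TWO); rewrite -FTWO => /full_trust_max.
by rewrite FTWO (gpt_WO gptG C).1 lt_gtF.
Qed.

(* [q] is the least probability of [C] at which full trust is still a best
   response; past it, player 1 moves on to [T1]. *)
Lemma full_trust_breakpoint : exists q T1,
  [/\ 0 < q < 1, T1 != WO, T1 != FT & 0 < aff (u1 G FT) q] /\
  [/\ forall T, aff (u1 G T) q <= aff (u1 G FT) q,
      aff (u1 G T1) q = aff (u1 G FT) q,
      forall y, y < q -> aff (u1 G FT) y < aff (u1 G T1) y &
      forall T, aff (u1 G T) q = aff (u1 G FT) q -> B T <= B T1].
Proof.
(* [w T] is the slope of the payoff difference between [FT] and [T], and [cross T] is its zero. *)
pose w T := (A FT - A T) + (B T - B FT).
pose cross T := (B T - B FT) / w T.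
have dA T : T != FT -> 0 < A FT - A T by move/full_trust_max; rewrite subr_gt0.
have dB T : T != FT -> 0 < B T - B FT.
  by move/full_trust_max/(gpt_monotone gptG) => [_ + _]; rewrite subr_gt0.
have w_gt0 T : T != FT -> 0 < w T by move=> TFT; rewrite addr_gt0 ?dA ?dB.
have aff_diff T y : T != FT ->
    aff (u1 G FT) y - aff (u1 G T) y = w T * (y - cross T).
  move=> TFT; rewrite mulrBr mulrC -[w T * cross T]mulrC divfK ?gt_eqF ?w_gt0//.
  by rewrite /aff /w; ring.
have WOFT : WO != FT by rewrite eq_sym full_trust_neq_WO.
(* The breakpoint is the largest crossing. *)
case: (@arg_maxP _ _ _ WO [pred T | T != FT] cross WOFT) => Tm /= TmFT Tm_max.
have Tm_P : (Tm != FT) && (cross Tm == cross Tm) by rewrite TmFT eqxx.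
(* Among the strategies crossing there, the one with the largest [B] is the best just below the
   breakpoint. *)
case: (@arg_maxP _ _ _ Tm [pred T | (T != FT) && (cross T == cross Tm)]
  (fun T => B T) Tm_P) => T1 /= /andP[T1FT /eqP T1q] T1_max.
have affT1 : aff (u1 G T1) (cross Tm) = aff (u1 G FT) (cross Tm).
  by apply/eqP; rewrite eq_sym -subr_eq0 aff_diff// T1q subrr mulr0.
(* Non-triviality says exactly that [FT] has positive payoff at its crossing with [T0]; this payoff
   increases up to the largest crossing. *)
have V_gt0 : 0 < aff (u1 G FT) (cross Tm).
  have [T0 T0WO T0nt] := ntG.
  have T0FT : T0 != FT by apply: contraTneq T0nt => ->; rewrite ltxx.
  have [AF BF _ _] := gpt_trust gptG full_trust_neq_WO.
  have [A0 B0 _ _] := gpt_trust gptG T0WO.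
  have cross_le := Tm_max _ T0FT.
  have : 0 < aff (u1 G FT) (cross T0).
    rewrite -(pmulr_rgt0 _ (w_gt0 _ T0FT)).
    have -> : w T0 * aff (u1 G FT) (cross T0) = A FT * B T0 - A T0 * B FT.
      have crossE : w T0 * cross T0 = B T0 - B FT.
        by rewrite mulrC divfK// gt_eqF// w_gt0.
      transitivity (w T0 * cross T0 * A FT + (w T0 - w T0 * cross T0) * B FT).
        by rewrite /aff; ring.
      by rewrite crossE /w; ring.
    move: T0nt; rewrite ltr_pdivrMr ?oppr_gt0// mulrAC ltr_pdivlMr ?oppr_gt0//.
    by rewrite !mulrN ltrN2 subr_gt0.
  move/lt_le_trans; apply; rewrite -subr_ge0.
  have -> : aff (u1 G FT) (cross Tm) - aff (u1 G FT) (cross T0) =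
    (cross Tm - cross T0) * (A FT - B FT) by rewrite /aff; ring.
  by rewrite mulr_ge0 ?subr_ge0// ltW// (lt_trans BF).
exists (cross Tm), T1; split; split => //.
- rewrite divr_gt0 ?dB ?w_gt0//= ltr_pdivrMr ?w_gt0// mul1r /w.
  by rewrite ltrDr dA.
- apply: contraTneq V_gt0 => T1WO; rewrite -affT1 T1WO aff_WO ?ltxx//; by left.
- move=> T; have [->//|TFT] := eqVneq T FT.
  by rewrite -subr_ge0 aff_diff// mulr_ge0 ?(ltW (w_gt0 _ _))// subr_ge0 Tm_max.
- move=> y yq; rewrite -subr_lt0 aff_diff// pmulr_rlt0 ?w_gt0// subr_lt0 T1q//.
- move=> T; have [-> _|TFT /eqP] := eqVneq T FT.
    by rewrite -subr_ge0 ltW// dB.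
  rewrite eq_sym -subr_eq0 aff_diff// mulf_eq0 gt_eqF ?w_gt0//=.
  rewrite subr_eq0 eq_sym => /eqP Tq.
  by apply: T1_max; rewrite TFT Tq eqxx.
Qed.

(** * The equilibrium of the simulation game *)

Lemma msim_pareto_of_large_payoff K :
  (forall T, T != FT -> T != WO -> u2 G T D * (A T - B T) <= K * - B T) ->
  0 <= K -> K < u2 G FT C ->
  msim_introduces_pareto_improving_NE G.
Proof.
move=> Kge K_ge0 KFT.
have [q [T1 [[q01 T1WO T1FT V_gt0] [FTq T1q FTlt T1_max]]]] :=
  full_trust_breakpoint.
have [q_gt0 q_lt1] := andP q01.
have [A1 B1 dc1 c1_gt0] := gpt_trust gptG T1WO.
have [AF BF dcF cF_gt0] := gpt_trust gptG full_trust_neq_WO.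
pose V := aff (u1 G FT) q.
(* If [T] is strictly worse than [FT] at [q], then [e < gap T] and [e < 2^-1] keep [T] below [T1]
   once weight [e] moves to defection: the factor 2 absorbs [1 - e], and the added 1 keeps the
   denominator positive. *)
pose gap T := if aff (u1 G T) q < V
  then (V - aff (u1 G T) q) / (2 * (`|B T - B T1| + 1)) else 1.
have gap_gt0 T : 0 < gap T.
  rewrite /gap; case: ifP => // TV; rewrite divr_gt0 ?subr_gt0// mulr_gt0.
have [e0 e0_gt0 e0_le] := exists_pos_lower_bound gap_gt0.
have VB : 0 < V - B T1 by rewrite subr_gt0 (lt_trans B1).
(* The last bound makes player 1's equilibrium payoff [V - e * (V - B T1)] positive. *)
pose e1 := Num.min e0 (Num.min 2^-1 (V / (V - B T1))).
have e1_gt0 : 0 < e1 by rewrite !lt_min e0_gt0 invr_gt0 ltr0n divr_gt0.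
exists (- B T1 * e1); first by rewrite mulr_gt0 ?oppr_gt0.
move=> c /andP[c_gt0 c_lt]; pose e := c / - B T1.
have e_gt0 : 0 < e by rewrite divr_gt0 ?oppr_gt0.
have cE : c = e * - B T1 by rewrite divfK// oppr_eq0 lt_eqF.
have : e < e1 by rewrite ltr_pdivrMr ?oppr_gt0// mulrC.
rewrite !lt_min => /and3P[e_e0 e_half]; rewrite ltr_pdivlMr// => eV.
have e01 : 0 <= 1 - e <= 1 by apply/andP; split; lra.
(* the weight on m-sim making player 2 indifferent between [q] and defection *)
pose W := aff (u2 G FT) q; pose k := q * (u2 G T1 D - u2 G T1 C).
have cFW : u2 G FT C <= W.
  rewrite /W /aff -subr_ge0.
  have -> : q * u2 G FT C + (1 - q) * u2 G FT D - u2 G FT C =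
    (1 - q) * (u2 G FT D - u2 G FT C) by ring.
  by rewrite mulr_ge0// subr_ge0 ltW.
have W_gt0 : 0 < W := lt_le_trans cF_gt0 cFW.
have k_gt0 : 0 < k by rewrite mulr_gt0// subr_gt0.
have Wk_gt0 : 0 < W + k by rewrite addr_gt0.
pose x := k / (W + k).
have x_gt0 : 0 < x by rewrite divr_gt0.
have x_lt1 : x < 1 by rewrite ltr_pdivrMr// mul1r ltrDr.
have xW : x * W = (1 - x) * k.
  have : x * (W + k) = k by rewrite divfK// gt_eqF.
  lra.
have x01 : 0 <= x <= 1 by rewrite !ltW.
have y01 : 0 <= q <= 1 by rewrite !ltW.
have z01 : 0 <= (0 : R) <= 1 by rewrite lexx ler01.
pose sigma := two_mixed C D y01; pose tau := two_mixed C D z01.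
have sC : sigma C = q := two_mixed_CD y01.
have tC : tau C = 0 := two_mixed_CD z01.
have [mu2 mu2E] := two_point_sim_expay S1 sigma tau e01.
pose mu1 := two_mixed None (Some T1) x01.
have bu1 := bounded_measurable_msim_u1 G c.
have bu2 := bounded_measurable_msim_u2 G c.
have q_le : q <= sigma C by rewrite sC.
have [m1s m2s] := msim_at_full_trust c (full_trust_br FTq q_le).
have [m1t m2t] := msim_at_defection c tC.
have aff0 f : aff f 0 = f D :> R by rewrite /aff mul0r add0r subr0 mul1r.
(* The equilibrium payoffs: [v1] is that of m-sim against [mu2], and [v2] that of defection against
   [mu1], since m-sim then walks out. *)
pose v1 := (1 - e) * V - c; pose v2 := (1 - x) * u2 G T1 D.
have v1_gt0 : 0 < v1 by rewrite /v1 cE; lra.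
have v2_gt0 : 0 < v2 by rewrite mulr_gt0 ?subr_gt0// (lt_trans c1_gt0).
pose pay1 s := (1 - e) * u1 (msim G c) s sigma + e * u1 (msim G c) s tau.
have pay1_None : pay1 None = v1 by rewrite /pay1 m1s m1t sC /v1 -/V; ring.
have pay1_Some T : pay1 (Some T) = (1 - e) * aff (u1 G T) q + e * B T.
  by rewrite /pay1 /= !epay_aff sC tC aff0.
have pay1_T1 : pay1 (Some T1) = v1 by rewrite pay1_Some T1q -/V /v1 cE; ring.
have pay1_le s : pay1 s <= v1.
  case: s => [T|]; last by rewrite pay1_None.
  rewrite -pay1_T1 !pay1_Some T1q -/V; have := FTq T; rewrite -/V le_eqVlt.
  (* Strategies tied at [q] are ruled out by the maximality of [B T1], the others by [gap]. *)
  case/orP => [/eqP TV|TV].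
    by rewrite TV lerD2l ler_pM2l// T1_max.
  have := e0_le T; rewrite /gap TV => /(lt_le_trans e_e0).
  have N_gt0 : 0 < 2 * (`|B T - B T1| + 1) by rewrite mulr_gt0.
  rewrite ltr_pdivlMr// => eN.
  have : e * (B T - B T1) <= e * `|B T - B T1| by rewrite ler_pM2l// ler_norm.
  have : 0 <= (2^-1 - e) * (V - aff (u1 G T) q).
    by rewrite mulr_ge0// subr_ge0 ltW.
  lra.
have sim1E mu : sim_expay (u1 (msim G c)) mu mu2 = \sum_s mu s * pay1 s.
  rewrite mu2E// !mulr_sumr -big_split; apply: eq_bigr => s _.
  by rewrite subKr mulrDr; congr (_ + _); rewrite mulrCA.
have sim1 : sim_expay (u1 (msim G c)) mu1 mu2 = v1.
  by rewrite sim1E sum_two_mixed pay1_None pay1_T1; ring.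
have pay2E (rho : mixed R action) : \sum_s mu1 s * u2 (msim G c) s rho =
    x * u2 (msim G c) None rho + (1 - x) * aff (u2 G T1) (rho C).
  by rewrite sum_two_mixed /= epay_aff.
have pay2_s : \sum_s mu1 s * u2 (msim G c) s sigma = v2.
  by rewrite pay2E m2s sC -/W xW /k /v2 /aff; ring.
have pay2_t : \sum_s mu1 s * u2 (msim G c) s tau = v2.
  by rewrite pay2E m2t tC aff0 mulr0 add0r.
have pay2_le (rho : mixed R action) : \sum_s mu1 s * u2 (msim G c) s rho <= v2.
  (* From [q] on, player 1's response stays [FT], and cooperating more only costs player 2. *)
  rewrite pay2E; have y_ge0 := mixed_ge0 rho C; have [qy|yq] := leP q (rho C).
    have [_ ->] := msim_at_full_trust c (full_trust_br FTq qy).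
    have aff_le T : aff (u2 G T) (rho C) <= aff (u2 G T) q.
      rewrite -subr_ge0.
      have -> : aff (u2 G T) q - aff (u2 G T) (rho C) =
        (rho C - q) * (u2 G T D - u2 G T C) by rewrite /aff; ring.
      by rewrite mulr_ge0 ?subr_ge0// u2_C_le_D.
    rewrite -pay2_s pay2E m2s sC; apply: lerD.
      by rewrite ler_pM2l.
    by rewrite ler_pM2l// subr_gt0.
  (* Below [q], [K < u2 G FT C <= W] bounds the simulated payoff by [rho C * W]; the indifference
     identity [xW] then shows that this gain is at most the loss against [T1]. *)
  apply: (@le_trans _ _ (x * (rho C * W) + (1 - x) * aff (u2 G T1) (rho C))).
    rewrite lerD2r ler_pM2l//.
    apply: le_trans (msim_u2_bound _ FTlt Kge K_ge0 yq) _.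
    by rewrite ler_wpM2l// ltW// (lt_le_trans KFT).
  rewrite mulrCA xW -subr_ge0.
  have -> : v2 - (rho C * ((1 - x) * k) + (1 - x) * aff (u2 G T1) (rho C)) =
    (1 - x) * (1 - q) * (rho C * (u2 G T1 D - u2 G T1 C)).
    by rewrite /v2 /k /aff; ring.
  by rewrite !mulr_ge0// subr_ge0 ltW.
have sim2 : sim_expay (u2 (msim G c)) mu1 mu2 = v2.
  by rewrite mu2E// pay2_s pay2_t; ring.
exists mu1, mu2; split; last first.
  move=> sigma1 sigma2 /NE_payoff0[-> ->].
  by rewrite sim1 sim2.
split=> [mu|mu]; first by rewrite sim1 sim1E; exact: mixed_average_le.
by rewrite sim2; exact: sim_expay_le.
Qed.

End Game.

(* The threshold K depends on all the payoffs other than u2 FT C, except for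
   u2 FT D: the latter must exceed u2 FT C, so it cannot be held fixed while
   u2 FT C grows, and K does not depend on it. The values of v2 at FT are not
   used. *)
Theorem theorem5p2 (R : realType) (S1 : finType) (WO FT : S1)
    (v1 v2 : S1 -> action -> R) :
  exists K : R, forall G : nfg R S1 action,
    (forall T a, u1 G T a = v1 T a) ->
    (forall T a, T != FT -> u2 G T a = v2 T a) ->
    gen_partial_trust G WO ->
    is_full_trust G FT ->
    nontrivial G WO FT ->
    u2 G FT C > K ->
    msim_introduces_pareto_improving_NE G.
Proof.
(* [r T] is the absolute value of the least constant admissible for [T] alone; a sum of nonnegative
   terms dominates each of them. *)
pose r T := `|v2 T D * (v1 T C - v1 T D) / v1 T D|.
exists (\sum_(T | T != FT) r T) => G v1E v2E gptG ftG ntG KFT.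
apply: (msim_pareto_of_large_payoff gptG ftG ntG _ _ KFT) => [T TFT TWO|].
  2: by apply: sumr_ge0 => T _; exact: normr_ge0.
have [_ BT _ _] := gpt_trust gptG TWO.
apply: (@le_trans _ _ (r T * - u1 G T D)).
  rewrite -ler_pdivrMr ?oppr_gt0// invrN mulrN -mulNr v2E// !v1E.
  by rewrite mulNr /r -normrN ler_norm.
rewrite ler_pM2r ?oppr_gt0// (bigD1 T)//= lerDl sumr_ge0// => S _.
exact: normr_ge0.
Qed.
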